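(* Let $X$ be a real Banach space and let $f:\mathbb{R}\to X$ be arbitrary. Then there exists a set $N\subset\mathbb{R}$ of Lebesgue measure zero such that: if $x\in\mathbb{R}\setminus N$ and $\min(mD^-(f,x),mD^+(f,x))<\infty$, then $md(f,x)$ exists.
   Context: For $f:\mathbb{R}\to X$ and $x\in\mathbb{R}$: $mD^{\pm}(f,x)=\limsup_{t\to0+}\frac{\|f(x\pm t)-f(x)\|}{t}\in[0,+\infty]$. The unilateral metric derivatives are $md_{\pm}(f,x)=\lim_{t\to0+}\frac{\|f(x\pm t)-f(x)\|}{t}$ (when the limit exists). If $md_+(f,x)$ and $md_-(f,x)$ exist and are equal (as finite numbers), one says that the metric derivative $md(f,x)$ exists and sets $md(f,x)=md_+(f,x)$. *)

(* Defs.v *)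
From HB Require Import structures.
From mathcomp Require Import all_boot all_order all_algebra.
From mathcomp Require Import all_classical all_reals all_analysis.

Set Implicit Arguments.
Unset Strict Implicit.
Unset Printing Implicit Defensive.

Import Order.TTheory GRing.Theory Num.Theory.
Import numFieldNormedType.Exports.

Local Open Scope classical_set_scope.
Local Open Scope ring_scope.

Section metric_derivative.
Context {R : realType} {X : normedModType R}.
Implicit Types (f : R -> X) (x : R).

Definition mquot_plus f x (t : R) : R := `|f (x + t) - f x| / t.
Definition mquot_minus f x (t : R) : R := `|f (x - t) - f x| / t.

Definition mD_plus f x : \bar R :=
  limf_esup (fun t => (mquot_plus f x t)%:E) 0^'+.
Definition mD_minus f x : \bar R :=
  limf_esup (fun t => (mquot_minus f x t)%:E) 0^'+.

(* Convergence is in R, so these limits exist only as finite numbers; [md_plus]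
   and [md_minus] are meaningful only under the corresponding [_exists]. *)
Definition md_plus_exists f x : Prop := cvg (mquot_plus f x t @[t --> 0^'+]).
Definition md_minus_exists f x : Prop := cvg (mquot_minus f x t @[t --> 0^'+]).

Definition md_plus f x : R := lim (mquot_plus f x t @[t --> 0^'+]).
Definition md_minus f x : R := lim (mquot_minus f x t @[t --> 0^'+]).

Definition md_exists f x : Prop :=
  [/\ md_plus_exists f x, md_minus_exists f x & md_plus f x = md_minus f x].

End metric_derivative.

(* Main.v *)
Require Import Defs.
From mathcomp Require Import finmap.
From mathcomp Require Import all_boot all_order all_algebra.
From mathcomp Require Import all_classical all_reals all_analysis.
From mathcomp Require Import measurable_realfun ring lra.

Set Implicit Arguments.
Unset Strict Implicit.
Unset Printing Implicit Defensive.

Import Order.TTheory GRing.Theory Num.Theory.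
Import numFieldNormedType.Exports.

Local Open Scope classical_set_scope.
Local Open Scope ring_scope.

(** Where a one-sided upper metric derivative is finite, [f] is, up to a
    countable decomposition of the points, Lipschitz on a set [E], and the
    values of [f] are controlled by those at the points of [E] lying just
    beside, on one fixed side. On an interval whose chord is steep, a Lipschitz
    [f] can have flat chords only over a fixed fraction of the length; so by
    Vitali's covering theorem the points of [E] at which both steep and flat
    chords along [E] accumulate form a null set, and almost everywhere the
    slopes converge along [E]. Almost every point [x] of [E] is moreover a
    density point of the closure of [E], hence every [y] near [x] has a point
    of [E] beside it, on the chosen side, at distance [o(|y - x|)]; this turns
    convergence along [E] into convergence along all [y --> x]. As [E] need
    not be measurable, lengths are compared through the outer measure. *)

Section countable_endpoints.
Context {R : realType}.
Implicit Types (S : set R) (D : set (R * R)).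

Lemma countable_isolated_right S :
  (forall x, S x -> \forall y \near x^'+, ~ S y) -> countable S.
Proof.
move=> isoS.
have /choice[b bP] : forall x, exists b,
    x < b /\ (S x -> forall y, x < y < b -> ~ S y).
  move=> x; have [/isoS|nSx] := pselect (S x); last first.
    by exists (x + 1); split=> //; rewrite ltrDl.
  rewrite near_withinE => /nbhs_ballP[d /= d0 xd].
  exists (x + d); split=> [|_ y /andP[xy yd]]; first by rewrite ltrDl.
  by apply: xd => //; rewrite ball_itv/= in_itv/= yd andbT; lra.
apply: (@separated_open_countable R R (fun x => `]x, b x[%classic)) => [x|x|].
- exact: interval_open.
- by have [xb _] := bP x; exists ((x + b x) / 2); rewrite /= in_itv/= !midf_lt.
- move=> x y Sx Sy [z [/=]]; rewrite !in_itv/= => /andP[xz zbx] /andP[yz zby].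
  apply: contrapT => /eqP; rewrite neq_lt => /orP[xy|yx].
  + by apply: ((bP x).2 Sx y) => //; rewrite xy (lt_trans yz).
  + by apply: ((bP y).2 Sy x) => //; rewrite yx (lt_trans xz).
Qed.

Lemma countable_isolated_left S :
  (forall x, S x -> \forall y \near x^'-, ~ S y) -> countable S.
Proof.
move=> isoS.
have : countable [set x | S (- x)].
  by apply: countable_isolated_right => x /isoS; rewrite at_leftN.
apply/sub_countable/(card_le_trans _ (card_image_le (@GRing.opp R) _)).
by apply: subset_card_le => x Sx; exists (- x); rewrite /= ?opprK.
Qed.

Lemma countable_itvcc_setD_itvoo D : (forall p, D p -> p.1 < p.2) ->
  countable (\bigcup_(p in D) `[p.1, p.2]%classic `\`
             \bigcup_(p in D) `]p.1, p.2[%classic).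
Proof.
move=> D12; set S := _ `\` _.
pose endpoints (left : bool) := S `&`
  [set x | exists2 p, D p & x = if left then p.1 else p.2].
have not_inside p y : D p -> S y -> ~ p.1 < y < p.2.
  by move=> Dp [_ ySD] py; apply: ySD; exists p => //=; rewrite in_itv.
have : countable (\bigcup_(left in [set: bool]) endpoints left).
  apply: bigcup_countable => // -[] _.
    apply: countable_isolated_right => x [_ [p Dp ->]].
    have p12 := D12 _ Dp; near=> y => -[Sy _]; apply: (not_inside _ _ Dp Sy).
    by apply/andP; split=> //; near: y; exact: nbhs_right_lt.
  apply: countable_isolated_left => x [_ [p Dp ->]].
  have p12 := D12 _ Dp; near=> y => -[Sy _]; apply: (not_inside _ _ Dp Sy).
  by apply/andP; split=> //; near: y; exact: nbhs_left_gt.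
apply/sub_countable/subset_card_le => x Sx.
have [[p Dp xp] _] := Sx.
move: xp (not_inside _ _ Dp Sx); rewrite /= in_itv/= => /andP[].
rewrite le_eqVlt => /predU1P[xp _ _|p1x].
  by exists true => //; split=> //; exists p.
rewrite le_eqVlt => /predU1P[xp _|xp2]; last by rewrite p1x.
by exists false => //; split=> //; exists p.
Unshelve. all: by end_near. Qed.

End countable_endpoints.

Section lebesgue_outer_measure.
Context {R : realType}.
Implicit Types (A B : set R).
Local Notation mu := (@lebesgue_measure R).
Local Open Scope ereal_scope.

Lemma le_lebesgue_measure A B : A `<=` B -> mu A <= mu B.
Proof. exact: (@le_outer_measure _ _ ((@wlength R idfun)^*)%mu). Qed.

Lemma lebesgue_measureU2_le A B : mu (A `|` B) <= mu A + mu B.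
Proof. exact: (@outer_measureU2 _ _ ((@wlength R idfun)^*)%mu). Qed.

Lemma lebesgue_measure_bigsetU_le (I : Type) (s : seq I) (F : I -> set R) :
  mu (\big[setU/set0]_(i <- s) F i) <= \sum_(i <- s) mu (F i).
Proof.
elim: s => [|i s IH]; first by rewrite !big_nil measure0.
by rewrite !big_cons (le_trans (lebesgue_measureU2_le _ _))// leeD2l.
Qed.

Lemma lebesgue_measure_setI_countable A B :
  countable (A `\` B) -> mu A <= mu (A `&` B).
Proof.
move=> cAB; rewrite -[X in X <= _](congr1 mu (setUIDK A B)).
rewrite (le_trans (lebesgue_measureU2_le _ _))//.
by rewrite [X in _ + X]countable_lebesgue_measure0// adde0.
Qed.

Lemma lebesgue_measure_itvcc_ge (a b : R) :
  (b - a)%:E <= mu `[a, b]%classic.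
Proof.
rewrite lebesgue_measure_itv/= lte_fin; case: ifPn => //.
by rewrite -leNgt lee_fin subr_le0.
Qed.

Lemma lebesgue_measure_setI_itvcc_le A (a b : R) :
  mu (A `&` `[a, b]%classic) <= mu (A `&` `]a, b[%classic).
Proof.
apply: (le_trans (@lebesgue_measure_setI_countable _ `]a, b[%classic _)).
  apply: sub_countable (finite_set_countable (finite_set2 a b)).
  apply/subset_card_le => x [[_]]; rewrite /= !in_itv/= => /andP[ax xb] /negP.
  rewrite negb_and -!leNgt => /orP[xa|bx].
    by left; apply/le_anti/andP.
  by right; apply/le_anti/andP.
by apply: le_lebesgue_measure => x [[]].
Qed.

Lemma ae_forall_countable (T : countType) (P : T -> R -> Prop) :
  (forall i, \forall x \ae mu, P i x) -> \forall x \ae mu, forall i, P i x.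
Proof.
move=> aeP; pose Q n x := if unpickle n is Some i then P i x else True.
have : \forall x \ae mu, forall n, Q n x.
  by apply: ae_foralln => n; rewrite /Q; case: unpickle => [i//|]; apply: aeW.
apply: (@filterS _ _ (ae_filter_ringOfSetsType mu)) => x Qx i.
by have := Qx (pickle i); rewrite /Q pickleK.
Qed.

End lebesgue_outer_measure.

Section interval_sequences.
Context {R : realType}.
Implicit Types (i j : R * R) (s : seq (R * R)).
Local Notation mu := (@lebesgue_measure R).

Definition itv_cover s : set R :=
  \big[setU/set0]_(i <- s) `[i.1, i.2]%classic.

Definition itv_before i j : bool := i.2 < j.1.

Lemma sum_length_le s (U : set R) : measurable U -> pairwise itv_before s ->
  (forall i, i \in s -> `[i.1, i.2]%classic `<=` U) ->
  ((\sum_(i <- s) (i.2 - i.1))%:E <= mu U)%E.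
Proof.
elim: s U => [|i s IH] U mU; first by rewrite big_nil.
rewrite pairwise_cons => /andP[/allP i_before pws] sU.
have iU := sU i (mem_head _ _).
rewrite big_cons EFinD -[in leRHS](setUIDK U `[i.1, i.2]%classic) measureU//.
- rewrite (setIidr iU) leeD ?lebesgue_measure_itvcc_ge//.
  apply: IH => // [|j sj x ix]; first exact: measurableD.
  split=> [|xi]; first by apply: (sU j) => //; rewrite inE sj orbT.
  move: ix xi; rewrite /= !in_itv/= => /andP[jx _] /andP[_ xi].
  by have := i_before _ sj; rewrite /itv_before ltNge (le_trans jx xi).
- exact: measurableI.
- exact: measurableD.
- by apply/seteqP; split=> // x /= [[_ ?] [_]].
Qed.

Lemma le_lebesgue_measure_itv_cover (A : set R) s :
  (mu A <= mu (A `\` itv_cover s) +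
           \sum_(i <- s) mu (A `&` `[i.1, i.2]%classic))%E.
Proof.
rewrite -[X in (mu X <= _)%E](setUIDK A (itv_cover s)) setUC.
rewrite (le_trans (lebesgue_measureU2_le _ _))// leeD2l//.
rewrite /itv_cover big_distrr/=; exact: lebesgue_measure_bigsetU_le.
Qed.

Lemma pairwise_itv_before_sort s : uniq s ->
  (forall i, i \in s -> i.1 <= i.2) ->
  (forall i j x, i \in s -> j \in s ->
    i.1 <= x <= i.2 -> j.1 <= x <= j.2 -> i = j) ->
  pairwise itv_before (sort (fun i j => i.1 <= j.1) s).
Proof.
pose le1 i j := i.1 <= j.1 => us s12 disj.
have le1_trans : transitive le1 by move=> j i k; exact: le_trans.
have : pairwise [rel i j | le1 i j && (i != j)] (sort le1 s).
  rewrite pairwise_relI -uniq_pairwise sort_uniq us andbT.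
  by rewrite -sorted_pairwise// sort_sorted// => i j; exact: le_total.
apply: (@sub_in_pairwise _ (mem s)); last by apply/allP => i; rewrite mem_sort.
move=> i j si sj /= /andP[ij]; apply: contraNT.
rewrite /itv_before -leNgt => ji.
by apply/eqP/(disj i j j.1) => //; rewrite ?lexx ?s12// ji andbT.
Qed.

End interval_sequences.

Section vitali_covering.
Context {R : realType}.
Implicit Types (A : set R) (F : set (R * R)) (i : R * R).
Local Notation mu := (@lebesgue_measure R).

Definition fine_cover F A := forall x, A x -> forall d, 0 < d ->
  exists2 i : R * R, F i & [/\ i.1 < i.2, i.1 <= x <= i.2 & i.2 - i.1 < d].

Definition fine_interior F : set R := [set x | forall d, 0 < d ->
  exists2 i : R * R, F i & i.1 < x < i.2 /\ i.2 - i.1 < d].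

Lemma fine_coverS F A B : B `<=` A -> fine_cover F A -> fine_cover F B.
Proof. by move=> BA FA x /BA; exact: FA. Qed.

Lemma fine_cover_open F A (U : set R) : open U -> A `<=` U ->
  fine_cover F A -> fine_cover (F `&` [set i | `[i.1, i.2] `<=` U]) A.
Proof.
move=> oU AU FA x Ax d d0.
have /nbhs_ballP[r /= r0 xrU] := open_nbhs_nbhs (conj oU (AU _ Ax)).
have [|i Fi [i12 /andP[ix xi] id]] := FA _ Ax (Num.min d r).
  by rewrite lt_min d0.
move: id; rewrite lt_min => /andP[id ir].
exists i; last by rewrite ix.
split=> // y; rewrite /= in_itv/= => /andP[iy yi]; apply: xrU.
by rewrite ball_itv/= in_itv/=; apply/andP; split; lra.
Qed.

Lemma countable_setD_fine_interior F A :
  fine_cover F A -> countable (A `\` fine_interior F).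
Proof.
move=> FA; pose short (r : rat) : set (R * R) :=
  F `&` [set i | i.1 < i.2 /\ i.2 - i.1 < ratr r].
have : countable (\bigcup_r (\bigcup_(i in short r) `[i.1, i.2]%classic `\`
    \bigcup_(i in short r) `]i.1, i.2[%classic)).
  apply: bigcup_countable => // r _.
  by apply: countable_itvcc_setD_itvoo => i [_ []].
apply/sub_countable/subset_card_le => x [Ax].
move=> /existsNP[d /not_implyP[d0 not_inside]].
have /rat_in_itvoo[r] := d0; rewrite in_itv/= => /andP[r0 rd].
exists r => //; split.
  by have [i Fi [i12 xi ir]] := FA x Ax _ r0; exists i; rewrite //= in_itv.
move=> [i [Fi [i12 ir]]]; rewrite /= in_itv/= => xi.
by apply: not_inside; exists i => //; split=> //; exact: lt_trans rd.
Qed.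

(* One short interval of [F] is kept for each triple of rationals [u, v, r]:
   it contains [u] and [v] in its interior and is shorter than [r]. *)
Lemma fine_interior_seq F : exists J : nat -> R * R,
  (forall n, (J n).1 < (J n).2) /\
  fine_interior F = fine_interior (F `&` range J).
Proof.
pose short (k : rat * rat * rat) : set (R * R) := F `&` [set i |
  [/\ i.1 < ratr k.1.1, ratr k.1.1 < ratr k.1.2 :> R,
      ratr k.1.2 < i.2 & i.2 - i.1 < ratr k.2]].
have /choice[J J_short] : forall k, exists i : R * R,
    i.1 < i.2 /\ (short k !=set0 -> short k i).
  move=> k; have [[i ki]|nk] := pselect (short k !=set0).
    by exists i; split=> //; have [_ [? ? ? _]] := ki; lra.
  by exists (0, 1).
exists (fun n => J (odflt (0, 0, 0) (unpickle n))); split.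
  by move=> n; have [] := J_short (odflt (0, 0, 0) (unpickle n)).
apply/seteqP; split=> x Fx d d0; last first.
  by have [i [Fi _]] := Fx _ d0; exists i.
have /rat_in_itvoo[r] := d0; rewrite in_itv/= => /andP[r0 rd].
have [i Fi [/andP[ix xi] ir]] := Fx _ r0.
have /rat_in_itvoo[u] := ix; rewrite in_itv/= => /andP[iu ux].
have /rat_in_itvoo[v] := xi; rewrite in_itv/= => /andP[xv vi].
pose k := (u, v, r).
have [_ /(_ _)[|FJ [Ju _ vJ Jr]]] := J_short k.
  by exists i; split=> //; split=> //=; exact: lt_trans xv.
exists (J k); first by split=> //; exists (pickle k) => //; rewrite pickleK.
by split; [rewrite (lt_trans Ju)//= (lt_trans xv)|exact: lt_trans rd].
Qed.

Definition itv_ball i : set R := ball ((i.1 + i.2) / 2) ((i.2 - i.1) / 2).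

Lemma itv_midpoint i : ((i.1 + i.2) / 2 - (i.2 - i.1) / 2 = i.1) *
  ((i.1 + i.2) / 2 + (i.2 - i.1) / 2 = i.2).
Proof. by split; field. Qed.

Lemma itv_ballE i : itv_ball i = `]i.1, i.2[%classic.
Proof. by rewrite /itv_ball ball_itv !itv_midpoint. Qed.

Lemma radius_itv_ball i : i.1 < i.2 ->
  (radius (itv_ball i))%:num = (i.2 - i.1) / 2.
Proof. by move=> i12; rewrite radius_ball_num// divr_ge0// subr_ge0 ltW. Qed.

Lemma closure_itv_ball i : i.1 < i.2 ->
  closure (itv_ball i) = `[i.1, i.2]%classic.
Proof.
move=> i12; rewrite closure_ballE closed_ball_itv ?divr_gt0 ?subr_gt0//.
by rewrite !itv_midpoint.
Qed.

Lemma vitali_cover_fine_interior F (J : nat -> R * R) :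
  (forall n, (J n).1 < (J n).2) ->
  vitali_cover (fine_interior (F `&` range J)) (itv_ball \o J) (F \o J).
Proof.
move=> J12; split=> [n|x FJx d d0]; first exact: is_ball_ball.
have [i [FJn [n _ nE]] [xJ Jd]] := FJx _ d0; rewrite -{}nE in FJn xJ Jd.
exists n; split=> //=; first by rewrite itv_ballE /= in_itv.
by rewrite radius_itv_ball//; have := J12 n; lra.
Qed.

Lemma vitali_fine_cover F A (e : R) :
  (mu A < +oo)%E -> fine_cover F A -> 0 < e ->
  exists s : seq (R * R), [/\ pairwise itv_before s,
    forall i, i \in s -> F i /\ i.1 < i.2 &
    (mu (A `\` itv_cover s) <= e%:E)%E].
Proof.
move=> Aoo FA e0; have [J [J12 FJ]] := fine_interior_seq F.
have radJ n : 0 < (radius ((itv_ball \o J) n))%:num.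
  by rewrite radius_itv_ball// divr_gt0// subr_gt0.
have fin_interior : (mu (A `&` fine_interior F) < +oo)%E.
  by apply: le_lt_trans Aoo; apply: le_lebesgue_measure => x [].
have coverJ : vitali_cover (A `&` fine_interior F) (itv_ball \o J) (F \o J).
  have [ballJ covers] := vitali_cover_fine_interior F J12.
  by split=> // x [_]; rewrite FJ; exact: covers.
have [G [GF tG AG]] := vitali_theorem_corollary radJ fin_interior coverJ e0.
have closureJ n x : (J n).1 <= x <= (J n).2 -> (closure \o (itv_ball \o J)) n x.
  by rewrite /= closure_itv_ball//= in_itv.
have disjJ n m x : n \in G -> m \in G ->
    (J n).1 <= x <= (J n).2 -> (J m).1 <= x <= (J m).2 -> n = m.
  by move=> nG mG /closureJ xn /closureJ xm; apply: tG => //; exists x.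
exists (sort (fun i j : R * R => i.1 <= j.1) [seq J n | n <- G]); split.
- apply: pairwise_itv_before_sort.
  + rewrite map_inj_in_uniq ?fset_uniq// => n m nG mG nm.
    by apply: (disjJ n m (J n).1) => //; rewrite -?nm lexx ltW.
  + by move=> i /mapP[n _ ->]; rewrite ltW.
  + move=> i j x /mapP[n nG ->] /mapP[m mG ->] xn xm.
    by rewrite (disjJ n m x).
- by move=> i; rewrite mem_sort => /mapP[n nG ->]; split=> //; exact: GF.
rewrite (le_trans (@lebesgue_measure_setI_countable _ _ (fine_interior F) _))//.
  apply: sub_countable (countable_setD_fine_interior FA).
  by apply: subset_card_le => x [[]].
rewrite (le_trans _ (ltW AG))//.
apply: le_lebesgue_measure => x [[Ax xs] Fx]; split=> //; apply: contra_not xs.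
rewrite /itv_cover (perm_big _ (permEl (perm_sort _ _))) big_map.
by under eq_bigr do rewrite /= closure_itv_ball//.
Qed.

Lemma lebesgue_measure_thin0 A (c : R) : (mu A < +oo)%E -> 0 <= c < 1 ->
  fine_cover [set i | (mu (A `&` `[i.1, i.2]) <= (c * (i.2 - i.1))%:E)%E] A ->
  mu A = 0%E.
Proof.
move=> Aoo /andP[c0 c1]; set F := [set i | _] => FA.
have /fineK AM : mu A \is a fin_num by rewrite ge0_fin_numE// measure_ge0.
set M := fine (mu A) in AM.
have M0 : 0 <= M by rewrite -lee_fin AM measure_ge0.
suff M_le0 : (1 - c) * M <= 0.
  by rewrite -AM; congr EFin; apply/le_anti; rewrite M0 andbT; nra.
apply/ler_addgt0Pr => e e0; rewrite add0r.
have e20 : 0 < e / 2 by rewrite divr_gt0.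
have [U [oU AU UA]] := outer_measure_open_le A e20.
have [s [pws sF As]] := vitali_fine_cover Aoo (fine_cover_open oU AU FA) e20.
have sum_s : \sum_(i <- s) (i.2 - i.1) <= M + e / 2.
  rewrite -lee_fin EFinD AM (le_trans _ UA)//.
  apply: sum_length_le => // [|i /sF[[]]//]; exact: open_measurable.
have : M <= e / 2 + c * \sum_(i <- s) (i.2 - i.1).
  rewrite -lee_fin AM EFinD (le_trans (le_lebesgue_measure_itv_cover A s))//.
  rewrite leeD// mulr_sumr -sumEFin big_seq [leRHS]big_seq.
  by apply: lee_sum => i /sF[[]].
by nra.
Qed.

Lemma negligible_thin A (c : R) : 0 <= c < 1 ->
  fine_cover [set i | (mu (A `&` `[i.1, i.2]) <= (c * (i.2 - i.1))%:E)%E] A ->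
  mu.-negligible A.
Proof.
move=> c01 FA.
have -> : A = \bigcup_n (A `&` ball 0 n%:R).
  rewrite -setI_bigcupr; apply/esym/setIidl => x _.
  by exists (Num.truncn `|x|).+1 => //; rewrite /ball/= sub0r normrN truncnS_gt.
apply: negligible_bigcup => n; apply/negligible_outer_measure.
apply: lebesgue_measure_thin0 c01 _.
  rewrite (le_lt_trans (le_lebesgue_measure (@subIsetr _ _ _)))//.
  by rewrite lebesgue_measure_ball// ltry.
move=> x [Ax _] d d0; have [i Fi xi] := FA x Ax d d0; exists i => //=.
by apply: le_trans Fi; apply: le_lebesgue_measure => y [[]].
Qed.

End vitali_covering.

Lemma cvg_rat_separated (R : realType) (T : Type) (F : set_system T)
    {FF : Filter F} (g : T -> R) (a b : R) :
  (\forall t \near F, a <= g t <= b) ->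
  (forall p q : rat, p < q ->
    (\forall t \near F, ratr p < g t) \/ (\forall t \near F, g t < ratr q)) ->
  cvg (g t @[t --> F]).
Proof.
move=> gab sep; have [F0|nF0] := pselect (F set0).
  by apply/cvg_ex; exists 0 => P _; exact: (@filterS _ F _ set0).
have proper P : (\forall t \near F, P t) -> exists t, P t.
  by move=> FP; apply: contrapT => /forallNP nP; apply: nF0; apply: filterS FP.
pose S := [set r | \forall t \near F, r <= g t].
have supS : has_sup S.
  split; first by exists a; apply: filterS gab => t /andP[].
  exists b => r rg; have [t [/= rt /andP[_]]] := proper _ (filterI rg gab).
  exact: le_trans.
apply/cvg_ex; exists (sup S); apply/cvgrPdist_lt => e e0.
have [r rg Sr] := sup_adherent e0 supS.
have /rat_in_itvoo[q] : sup S < sup S + e by rewrite ltrDl.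
rewrite in_itv/= => /andP[Sq qe].
have /rat_in_itvoo[p] := Sq; rewrite in_itv/= => /andP[Sp].
rewrite ltr_rat => /sep[pg|gq].
  have : S (ratr p) by apply: filterS pg => t; exact: ltW.
  by move=> /(sup_upper_bound supS); rewrite leNgt Sp.
apply: filterS2 rg gq => t rt tq; rewrite ltr_distlC; apply/andP; split; lra.
Qed.

Section chord_slope.
Context {R : realType} {X : normedModType R}.
Implicit Types (f : R -> X) (E A : set R) (P : set R).
Local Notation mu := (@lebesgue_measure R).

Definition chord_slope f (x y : R) : R := `|f y - f x| / `|y - x|.

Lemma chord_slope_ge0 f x y : 0 <= chord_slope f x y.
Proof. by rewrite divr_ge0. Qed.

Lemma chord_slopeC f x y : chord_slope f x y = chord_slope f y x.
Proof. by rewrite /chord_slope distrC [ `|y - x| ]distrC. Qed.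

Lemma chord_slope_lipschitz f E (L : R) x y : L.-lipschitz_E f ->
  E x -> E y -> x != y -> chord_slope f x y <= L.
Proof.
move=> lipf Ex Ey xy; rewrite ler_pdivrMr ?normr_gt0 ?subr_eq0 1?eq_sym//.
exact: (lipf (y, x)).
Qed.

Lemma norm_chord f x y : `|f y - f x| = chord_slope f x y * `|y - x|.
Proof.
have [->|xy] := eqVneq x y; first by rewrite !subrr !normr0 mulr0.
by rewrite divfK// normr_eq0 subr_eq0 eq_sym.
Qed.

(* Cross the intervals of [s] at slope [p] and the gaps at slope [L]. *)
Lemma lipschitz_chain f E (L p : R) (s : seq (R * R)) (a b : R) :
  L.-lipschitz_E f -> E a -> E b -> a <= b -> pairwise itv_before s ->
  (forall i, i \in s -> [/\ E i.1, E i.2, a <= i.1 < i.2, i.2 <= b &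
    chord_slope f i.1 i.2 <= p]) ->
  `|f b - f a| <= L * (b - a) - (L - p) * \sum_(i <- s) (i.2 - i.1).
Proof.
move=> lipf.
have lip_le x y : E x -> E y -> x <= y -> `|f y - f x| <= L * (y - x).
  move=> Ex Ey xy; rewrite -[y - x]ger0_norm ?subr_ge0//.
  exact: (lipf (y, x)).
elim: s a => [|i s IH] a Ea Eb ab.
  by move=> _ _; rewrite big_nil mulr0 subr0; exact: lip_le.
rewrite pairwise_cons => /andP[/allP i_before pws] sE.
have [Ei1 Ei2 /andP[ai i12] ib slope_i] := sE i (mem_head _ _).
have rest : `|f b - f i.2| <=
    L * (b - i.2) - (L - p) * \sum_(j <- s) (j.2 - j.1).
  apply: IH => // j sj; have [|Ej1 Ej2 /andP[_ j12] jb slope_j] := sE j.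
    by rewrite inE sj orbT.
  by split=> //; rewrite j12 andbT ltW//; exact: i_before.
have across : `|f i.2 - f i.1| <= p * (i.2 - i.1).
  by rewrite norm_chord gtr0_norm ?subr_gt0// ler_wpM2r// subr_ge0 ltW.
have before := lip_le _ _ Ea Ei1 ai.
have := ler_distD (f i.2) (f b) (f a).
have := ler_distD (f i.1) (f i.2) (f a).
by rewrite big_cons; lra.
Qed.

Definition chords f E P : set (R * R) :=
  [set i | [/\ E i.1, E i.2 & P (chord_slope f i.1 i.2)]].

Definition chord_cluster f E P : set R :=
  [set x | E x /\ ~ \forall y \near within E x^', ~ P (chord_slope f x y)].

Lemma fine_cover_chords f E P : fine_cover (chords f E P) (chord_cluster f E P).
Proof.
move=> x [Ex clP] d d0; apply: contrapT => noi; apply: clP.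
rewrite near_withinE near_withinE; apply/nbhs_ballP; exists d => //= y.
rewrite ball_itv/= in_itv/= => /andP[xy yx].
rewrite neq_lt => /orP[lt_yx|lt_xy] Ey Py; apply: noi.
- exists (y, x); first by split=> //=; rewrite chord_slopeC.
  by rewrite /= (ltW lt_yx) lexx; split=> //; lra.
- by exists (x, y) => //=; rewrite (ltW lt_xy) lexx; split=> //; lra.
Qed.

Lemma flat_chords_measure_le f E A (L p q a b : R) :
  L.-lipschitz_E f -> p < L -> E a -> E b -> a < b -> q <= chord_slope f a b ->
  A `<=` `]a, b[ -> fine_cover (chords f E [set v | v <= p]) A ->
  (mu A <= ((L - q) / (L - p) * (b - a))%:E)%E.
Proof.
move=> lipf pL Ea Eb ab qf Aab FA; apply/lee_addgt0Pr => e e0.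
have Aoo : (mu A < +oo)%E.
  rewrite (le_lt_trans (le_lebesgue_measure Aab))//.
  by rewrite lebesgue_measure_itv/= lte_fin ab -EFinB ltry.
have oab : open `]a, b[%classic by exact: interval_open.
have [s [pws sF As]] := vitali_fine_cover Aoo (fine_cover_open oab Aab FA) e0.
have sum_s : \sum_(i <- s) (i.2 - i.1) <= (L - q) / (L - p) * (b - a).
  have chain : `|f b - f a| <=
      L * (b - a) - (L - p) * \sum_(i <- s) (i.2 - i.1).
    apply: (lipschitz_chain lipf) => //; first exact: ltW.
    move=> i /sF[[[Ei1 Ei2 slope_i] iab] i12].
    have /iab : `[i.1, i.2]%classic i.1 by rewrite /= in_itv/= lexx ltW.
    have /iab : `[i.1, i.2]%classic i.2 by rewrite /= in_itv/= lexx ltW.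
    rewrite /= !in_itv/= => /andP[_ ib] /andP[ai _].
    by split; rewrite ?i12 ?(ltW ai) ?(ltW ib).
  rewrite mulrAC ler_pdivlMr ?subr_gt0// mulrC.
  have : q * (b - a) <= `|f b - f a|.
    by rewrite norm_chord gtr0_norm ?subr_gt0// ler_wpM2r// subr_ge0 ltW.
  by lra.
rewrite (le_trans (le_lebesgue_measure_itv_cover A s))// addeC leeD//.
apply: (@le_trans _ _ (\sum_(i <- s) (i.2 - i.1))%:E); last by rewrite lee_fin.
rewrite -sumEFin big_seq [leRHS]big_seq; apply: lee_sum => i /sF[_ i12].
rewrite (le_trans (le_lebesgue_measure (@subIsetr _ _ _)))//.
by rewrite lebesgue_measure_itv/= lte_fin i12.
Qed.

Lemma negligible_chord_oscillation f E (L p q : R) :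
  L.-lipschitz_E f -> p < q ->
  mu.-negligible (chord_cluster f E [set v | v <= p] `&`
                  chord_cluster f E [set v | q <= v]).
Proof.
move=> lipf pq; set B := _ `&` _; pose K := Num.max L q.
have qK : q <= K by rewrite le_max lexx orbT.
have pK : p < K by exact: lt_le_trans qK.
have lipK : K.-lipschitz_E f.
  move=> z Ez; apply: (le_trans (lipf _ Ez)).
  by rewrite ler_wpM2r// le_max lexx.
apply: (@negligible_thin _ _ ((K - q) / (K - p))).
  by rewrite divr_ge0 ?subr_ge0 ?(ltW pK)//= ltr_pdivrMr ?subr_gt0//; lra.
move=> x [_ steep] d d0.
have [i [Ei1 Ei2 qi] [i12 xi id]] := fine_cover_chords steep d0.
exists i => //=; rewrite (le_trans (lebesgue_measure_setI_itvcc_le _ _ _))//.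
apply: (flat_chords_measure_le lipK) => //.
by apply: (fine_coverS _ (@fine_cover_chords f E _)) => y [[]].
Qed.

Lemma ae_cvg_chord_slope f E (L : R) : L.-lipschitz_E f ->
  {ae mu, forall x, E x -> cvg (chord_slope f x y @[y --> within E x^'])}.
Proof.
move=> lipf.
pose separated (pq : rat * rat) x := E x -> pq.1 < pq.2 ->
  (\forall y \near within E x^', ratr pq.1 < chord_slope f x y) \/
  (\forall y \near within E x^', chord_slope f x y < ratr pq.2).
have : {ae mu, forall x pq, separated pq x}.
  apply: ae_forall_countable => -[p q].
  have [pq|npq] := boolP (p < q); last first.
    by apply: aeW => x _; rewrite (negbTE npq).
  have pqR : ratr p < ratr q :> R by rewrite ltr_rat.
  apply: (negligibleS _ (negligible_chord_oscillation lipf pqR)) => x /=.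
  move=> /not_implyP[Ex /not_implyP[_ /not_orP[np nq]]].
  by split; split=> //; [apply: contra_not np|apply: contra_not nq];
    apply: filterS => y /negP; rewrite -ltNge.
apply: (@filterS _ _ (ae_filter_ringOfSetsType mu)) => x sep Ex.
apply: (@cvg_rat_separated _ _ _ _ _ 0 L) => [|p q]; last exact: (sep (p, q)).
rewrite 2!near_withinE; near=> y => yx Ey.
by rewrite chord_slope_ge0 (chord_slope_lipschitz lipf)// eq_sym.
Unshelve. all: by end_near. Qed.

End chord_slope.

Section porosity.
Context {R : realType}.
Implicit Types (E : set R).
Local Notation mu := (@lebesgue_measure R).

Definition nonporous_at E x := forall k : R, 0 < k -> \forall r \near 0^'+,
  forall c, ball c (k * r) `<=` ball x r -> E `&` ball c (k * r) !=set0.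

(* At a density point [x] of the closure of [E], a ball of radius [k * r] in
   [ball x r] that misses [E] would leave it a proportion at most [1 - k]. *)
Lemma ae_nonporous E : {ae mu, forall x, E x -> nonporous_at E x}.
Proof.
have mE : measurable (closure E).
  by apply: closed_measurable; exact: closed_closure.
apply: (@filterS _ _ (ae_filter_ringOfSetsType mu) _ _ _ (lebesgue_density mE)).
move=> x dens Ex k k0.
rewrite indicE mem_set in dens; last exact: subset_closure.
have /dens : ereal_nbhs 1%:E [set u | (1 - k)%:E < u]%E.
  by apply: open_ereal_gt'; rewrite lte_fin; lra.
apply: filterS2 (nbhs_right_gt 0) => r /= r0 dens_r c cx.
apply/set0P/negP => /eqP Ec0; move: dens_r; apply/negP; rewrite -leNgt.
have kr0 : 0 < k * r by exact: mulr_gt0.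
have -> : ((mu (ball x r))^-1 = ((r *+ 2)^-1)%:E)%E.
  by rewrite (lebesgue_measure_ball _ (ltW r0)) inver mulrn_eq0/= gt_eqF.
have -> : (1 - k)%:E = ((r *+ 2 - (k * r) *+ 2)%:E * ((r *+ 2)^-1)%:E)%E.
  by rewrite -EFinM; congr EFin; field; rewrite gt_eqF.
rewrite lee_pmul2r ?lte_fin ?invr_gt0 ?mulrn_wgt0//.
apply: (@le_trans _ _ (mu (ball x r `\` ball c (k * r)))).
  apply: le_lebesgue_measure => y [clEy xy]; split=> // cy.
  have [z [Ez cz]] := clEy _ (open_nbhs_nbhs (conj (ball_open c (k * r)) cy)).
  by have : (E `&` ball c (k * r)) z by []; rewrite Ec0.
rewrite measureD; [|exact: measurable_ball..|]; last first.
  by rewrite [X in (X < _)%E](lebesgue_measure_ball _ (ltW r0)) ltry.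
rewrite (setIidr cx) [X in (X - _)%E](lebesgue_measure_ball _ (ltW r0)).
by rewrite [X in (_ - X)%E](lebesgue_measure_ball _ (ltW kr0)).
Qed.

Lemma near_dnbhs_dist (P : set R) (c x : R) : 0 < c ->
  (\forall r \near 0^'+, P r) -> \forall y \near x^', P (c * `|y - x|).
Proof.
move=> c0; rewrite near_withinE => /nbhs_ballP[d /= d0 dP].
rewrite near_withinE; apply/nbhs_ballP; exists (d / c); first exact: divr_gt0.
move=> y; rewrite /ball/= distrC ltr_pdivlMr// => yd yx.
apply: dP; last by rewrite mulr_gt0// normr_gt0 subr_eq0.
by rewrite /ball/= sub0r normrN normrM normr_id (gtr0_norm c0) mulrC.
Qed.

Lemma nonporous_one_sided E (b : bool) (k x : R) : nonporous_at E x -> 0 < k ->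
  \forall y \near x^',
    exists2 z, E z & 0 < (-1) ^+ b * (y - z) < k * `|y - x|.
Proof.
move=> npE k0; have k1 : 0 < 1 + k by rewrite addr_gt0.
pose c := k / 2 / (1 + k); have c0 : 0 < c by rewrite !divr_gt0.
have balls_meet_E := near_dnbhs_dist x k1 (npE _ c0).
near=> y; have yx0 : 0 < `|y - x|.
  by rewrite normr_gt0 subr_eq0; near: y; exact: nbhs_dnbhs_neq.
pose r := k / 2 * `|y - x|; have r0 : 0 < r by rewrite !mulr_gt0.
have crE : c * ((1 + k) * `|y - x|) = r by rewrite /c /r; field; rewrite gt_eqF.
pose m := y - (-1) ^+ b * r.
have [z [Ez mz]] : E `&` ball m (c * ((1 + k) * `|y - x|)) !=set0.
  suff : ball m (c * ((1 + k) * `|y - x|)) `<=` ball x ((1 + k) * `|y - x|).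
    by move: (m); near: y; exact: balls_meet_E.
  rewrite crE => z; rewrite /ball/= => mz.
  have ym : `|y - m| = r by rewrite /m subKr normrMsign gtr0_norm.
  have := ler_distD y x z; have := ler_distD m y z.
  by rewrite [ `|x - y| ]distrC; move: mz ym; rewrite /r; lra.
exists z => //.
have : `|(-1) ^+ b * (y - z) - r| < r.
  move: mz; rewrite crE /ball/= -(normrMsign b) /m.
  by rewrite -addrA [- _ - z]addrC addrA mulrBr signrMK.
have -> : k * `|y - x| = 2 * r by rewrite /r; field.
by rewrite ltr_norml => /andP[? ?]; apply/andP; split; lra.
Unshelve. all: by end_near. Qed.

End porosity.

Section approximation.
Context {R : realType} {X : normedModType R}.
Implicit Types (f : R -> X) (E : set R) (b : bool).

Lemma chord_slope_dist f (x y z k : R) : y != x ->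
  `|z - y| <= k * `|y - x| -> `|f z - f y| <= k * `|y - x| ->
  `|chord_slope f x y - chord_slope f x z| <= k * (1 + chord_slope f x z).
Proof.
move=> yx zy fzy; have yx0 : 0 < `|y - x| by rewrite normr_gt0 subr_eq0.
rewrite -(ler_pM2r yx0) -[in leLHS](gtr0_norm yx0) -normrM.
have -> : (chord_slope f x y - chord_slope f x z) * `|y - x| =
    (`|f y - f x| - `|f z - f x|) + chord_slope f x z * (`|z - x| - `|y - x|).
  by rewrite !norm_chord; ring.
have -> : k * (1 + chord_slope f x z) * `|y - x| =
    k * `|y - x| + chord_slope f x z * (k * `|y - x|) by ring.
rewrite (le_trans (ler_normD _ _))// lerD//.
  by rewrite (le_trans (ler_dist_dist _ _))// opprB addrA subrK distrC.
rewrite normrM (ger0_norm (chord_slope_ge0 _ _ _)) ler_wpM2l ?chord_slope_ge0//.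
by rewrite (le_trans (ler_dist_dist _ _))// opprB addrA subrK.
Qed.

Definition approximated_along f E x := forall k : R, 0 < k ->
  \forall y \near x^', exists2 z, E z &
    `|z - y| <= k * `|y - x| /\ `|f z - f y| <= k * `|y - x|.

Lemma cvg_chord_slope_approximated f E (x l : R) : approximated_along f E x ->
  chord_slope f x y @[y --> within E x^'] --> l ->
  chord_slope f x y @[y --> x^'] --> l.
Proof.
move=> approx /cvgrPdist_le cvgE; apply/cvgrPdist_le => e e0.
have e20 : 0 < e / 2 by rewrite divr_gt0.
have := cvgE _ e20; rewrite 2!near_withinE => /nbhs_ballP[d /= d0 dE].
have c0 : 0 < 1 + `|l| + e / 2 by rewrite addr_gt0// ltr_pwDl.
pose k := Num.min (1 / 2) (e / 2 / (1 + `|l| + e / 2)).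
have k0 : 0 < k by rewrite lt_min !divr_gt0.
have k12 : k <= 1 / 2 by rewrite ge_min lexx.
have ke : k * (1 + `|l| + e / 2) <= e / 2.
  by rewrite -ler_pdivlMr// ge_min lexx orbT.
near=> y.
have yx : y != x by near: y; exact: nbhs_dnbhs_neq.
have yx0 : 0 < `|y - x| by rewrite normr_gt0 subr_eq0.
have yd : 2 * `|y - x| < d.
  by near: y; exact: near_dnbhs_dist (nbhs_right_lt d0).
have [z Ez [zy fzy]] : exists2 z, E z &
    `|z - y| <= k * `|y - x| /\ `|f z - f y| <= k * `|y - x|.
  by near: y; exact: approx.
have kyx : k * `|y - x| <= `|y - x| / 2 by rewrite mulrC ler_pM2l//; lra.
have zx0 : 0 < `|z - x|.
  by have := ler_distD z y x; rewrite [ `|y - z| ]distrC; lra.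
have slope_z : `|l - chord_slope f x z| <= e / 2.
  apply: dE => //; last by rewrite -subr_eq0 -normr_gt0.
  by rewrite /ball/= distrC; have := ler_distD y z x; lra.
rewrite (le_trans (ler_distD (chord_slope f x z) _ _))//.
have slope_yz := chord_slope_dist yx zy fzy.
have slope_z_le : chord_slope f x z <= `|l| + e / 2.
  move: slope_z; rewrite ler_norml => /andP[]; have := ler_norm l; lra.
rewrite [leRHS]splitr lerD// distrC (le_trans slope_yz)// (le_trans _ ke)//.
by rewrite ler_wpM2l ?(ltW k0)// -addrA lerD2l.
Unshelve. all: by end_near. Qed.

Definition lip_side f b (L h : R) : set R :=
  [set x | forall t, 0 < t < h -> `|f (x + (-1) ^+ b * t) - f x| <= L * t].

Lemma lip_side_lipschitz f E b (L h : R) : E `<=` lip_side f b L h ->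
  (forall x y, E x -> E y -> `|y - x| < h) -> L.-lipschitz_E f.
Proof.
move=> lipE diamE.
have lip_lt x y : E x -> E y -> x < y -> `|f y - f x| <= L * (y - x).
  move=> Ex Ey xy; have := diamE _ _ Ex Ey.
  rewrite gtr0_norm ?subr_gt0// => yxh.
  have yx : 0 < y - x < h by rewrite subr_gt0 xy.
  have := lipE _ Ex _ yx; have := lipE _ Ey _ yx.
  case: (b) => /=; last by rewrite expr0 mul1r subrKC.
  by rewrite expr1 mulN1r opprB subrKC distrC.
case=> x y [/= Ex Ey]; case: (ltgtP x y) => [xy|yx|->].
- by rewrite distrC [ `|x - y| ]distrC [ `|y - x| ]gtr0_norm ?subr_gt0// lip_lt.
- by rewrite [ `|x - y| ]gtr0_norm ?subr_gt0// lip_lt.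
- by rewrite !subrr !normr0 mulr0.
Qed.

Lemma approximated_along_nonporous f E b (L h x : R) : 0 < h ->
  E `<=` lip_side f b L h -> nonporous_at E x -> approximated_along f E x.
Proof.
move=> h0 lipE npE k k0; pose c := k / (`|L| + 1).
have L1 : 0 < `|L| + 1 by rewrite ltr_wpDl.
have c0 : 0 < c by rewrite divr_gt0.
have kE : k = `|L| * c + c by rewrite /c; field; rewrite gt_eqF.
near=> y.
have ch : c * `|y - x| < h.
  by near: y; exact: near_dnbhs_dist (nbhs_right_lt h0).
have [z Ez] : exists2 z, E z & 0 < (-1) ^+ b * (y - z) < c * `|y - x|.
  by near: y; exact: nonporous_one_sided.
set t := _ * (y - z) => /andP[t0 tc].
have yE : y = z + (-1) ^+ b * t by rewrite signrMK subrKC.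
have cyx0 : 0 <= c * `|y - x| by rewrite mulr_ge0// ltW.
have Lcyx0 : 0 <= `|L| * (c * `|y - x|) by exact: mulr_ge0.
exists z => //; rewrite kE mulrDl -mulrA; split.
  by rewrite distrC -(normrMsign b) -/t gtr0_norm//; lra.
have fzy : `|f z - f y| <= L * t.
  by rewrite distrC [in f y]yE; apply: lipE => //; rewrite t0 (lt_trans tc).
have : L * t <= `|L| * (c * `|y - x|).
  by rewrite (le_trans (ler_norm _))// normrM (gtr0_norm t0) ler_wpM2l// ltW.
by lra.
Unshelve. all: by end_near. Qed.

Lemma cvg_dnbhs_sign b (x : R) : x + (-1) ^+ b * t @[t --> 0^'+] --> x^'.
Proof.
move=> A xA.
have /nbhs_ballP[d /= d0 dA] : \forall y \near x, y != x -> A y := xA.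
suff: \forall t \near 0^'+, A (x + (-1) ^+ b * t) by [].
near=> t; have t0 : 0 < t by [].
apply: dA.
  by rewrite /ball/= opprD addrA subrr add0r normrN normrMsign gtr0_norm.
by rewrite addrC -subr_eq0 addrK mulf_neq0 ?signr_eq0// gt_eqF.
Unshelve. all: by end_near. Qed.

Lemma md_exists_cvg_chord_slope f (x l : R) :
  chord_slope f x y @[y --> x^'] --> l -> md_exists f x.
Proof.
move=> cvg_l.
have side b : `|f (x + (-1) ^+ b * t) - f x| / t @[t --> 0^'+] --> l.
  apply: (cvg_trans _ (cvg_comp _ _ (@cvg_dnbhs_sign b x) cvg_l)).
  apply: near_eq_cvg; near=> t; have t0 : 0 < t by [].
  by rewrite /= /chord_slope addrAC subrr add0r normrMsign gtr0_norm.
have plus_l : mquot_plus f x t @[t --> 0^'+] --> l.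
  by have := side false; under eq_fun do rewrite expr0 mul1r.
have minus_l : mquot_minus f x t @[t --> 0^'+] --> l.
  by have := side true; under eq_fun do rewrite expr1 mulN1r.
split; [by apply/cvg_ex; exists l|by apply/cvg_ex; exists l|].
by rewrite /md_plus /md_minus (cvg_lim _ plus_l)// (cvg_lim _ minus_l).
Unshelve. all: by end_near. Qed.

Lemma ae_md_exists f E b (L h : R) : 0 < h -> E `<=` lip_side f b L h ->
  (forall x y, E x -> E y -> `|y - x| < h) ->
  {ae lebesgue_measure, forall x, E x -> md_exists f x}.
Proof.
move=> h0 lipE diamE.
have lipf := lip_side_lipschitz lipE diamE.
apply: (@filterS2 _ _ (ae_filter_ringOfSetsType _) _ _ _ _
  (ae_cvg_chord_slope lipf) (ae_nonporous E)) => x cvgE npE Ex.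
have /cvg_ex[l cvg_l] := cvgE Ex; apply: (@md_exists_cvg_chord_slope _ _ l).
apply: cvg_chord_slope_approximated cvg_l.
exact: (approximated_along_nonporous h0 lipE (npE Ex)).
Qed.

End approximation.

Lemma limf_esup_lt_pinfty (R : realType) (T : choiceType) (Y : filteredType T)
    (F : set_system Y) {FF : Filter F} (g : Y -> R) :
  (limf_esup (fun t => (g t)%:E) F < +oo)%E ->
  exists M, \forall t \near F, g t <= M.
Proof.
rewrite /limf_esup => /ereal_inf_lt[_ [V FV <-] Voo].
have gV t : V t -> ((g t)%:E <= ereal_sup ((fun t => (g t)%:E) @` V))%E.
  by move=> Vt; apply: ereal_sup_ubound; exists t.
move: Voo gV; case: (ereal_sup _) => [M| |]// _ gV; last first.
  by exists 0; apply: filterS FV => t /gV.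
by exists M; apply: filterS FV => t /gV; rewrite lee_fin.
Qed.

Lemma lip_side_limf_esup (R : realType) (X : normedModType R) (f : R -> X)
    (b : bool) (x : R) :
  (limf_esup (fun t : R => (`|f (x + (-1) ^+ b * t) - f x| / t)%:E) 0^'+
    < +oo)%E ->
  exists n : nat, lip_side f b n%:R n.+1%:R^-1 x.
Proof.
move=> /limf_esup_lt_pinfty[M].
rewrite near_withinE => /nbhs_ballP[d /= d0 dM].
exists (Num.truncn (Num.max M d^-1)).+1; set n := _.+1.
have : Num.max M d^-1 < n%:R by exact: truncnS_gt.
rewrite gt_max => /andP[Mn dn] t /andP[t0 tn].
rewrite -ler_pdivrMr// (le_trans _ (ltW Mn))//; apply: dM => //=.
rewrite /ball/= sub0r normrN gtr0_norm// (lt_trans tn)//.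
by rewrite invf_plt ?posrE// (lt_le_trans dn)// ler_nat.
Qed.

Theorem corollary3p6 (R : realType) (X : completeNormedModType R)
    (f : R -> X) :
  exists N : set R,
    (@lebesgue_measure R).-negligible N /\
    (forall x : R, ~ N x ->
       (Order.min (mD_minus f x) (mD_plus f x) < +oo)%E ->
       md_exists f x).
Proof.
pose h (n : nat) : R := n.+1%:R^-1.
have h0 n : 0 < h n by rewrite invr_gt0.
pose E (i : bool * nat * rat) : set R :=
  lip_side f i.1.1 i.1.2%:R (h i.1.2) `&` ball (ratr i.2 : R) (h i.1.2 / 2).
have ae_E : {ae lebesgue_measure, forall x i, E i x -> md_exists f x}.
  apply: ae_forall_countable => -[[b n] r].
  apply: (@ae_md_exists _ _ _ _ b n%:R (h n)) => // [x []//|x y [_ xr] [_ yr]].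
  by rewrite distrC; exact: (ball_splitr xr yr).
exists (~` [set x | forall i, E i x -> md_exists f x]); split=> //.
move=> x /contrapT md_x mD_fin.
have [b [n lip_x]] : exists b n, lip_side f b n%:R (h n) x.
  by move: mD_fin; rewrite gt_min => /orP[mD_fin|mD_fin];
    [exists true|exists false]; apply: lip_side_limf_esup;
    under eq_fun do rewrite ?mulN1r ?mul1r.
have /rat_in_itvoo[r] : x - h n / 2 < x + h n / 2 by have := h0 n; lra.
rewrite in_itv/= => /andP[xr rx]; apply: (md_x (b, n, r)); split=> //=.
by rewrite ball_itv/= in_itv/=; apply/andP; split; lra.
Qed.
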